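(* There are infinitely many (even) positive integers $k$ for which there are, up to isomorphism, only finitely many connected symmetric cubic graphs of order $kp$ with $p$ prime. In particular, this is true for all $k$ of the form $2\ell$ where $\ell$ is a prime congruent to $5$ modulo $6$.
   Context: All graphs are finite, simple and undirected. The order of a graph is its number of vertices. Cubic means regular of valency $3$. A graph is symmetric (arc-transitive) if its automorphism group has a single orbit on the set of ordered pairs of adjacent vertices. The prime $p$ is not fixed: the finiteness is over all primes $p$ simultaneously. *)

(* Defs.v *)
From mathcomp Require Import all_boot all_fingroup.

Set Implicit Arguments.
Unset Strict Implicit.
Unset Printing Implicit Defensive.

Record sgraph := SGraph {
  svertex :> finType;
  sedge : rel svertex;
  sedge_sym : symmetric sedge;
  sedge_irrefl : irreflexive sedge
}.

Definition graph_iso (G H : sgraph) : Prop :=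
  exists2 f : G -> H, bijective f &
    forall x y, sedge (f x) (f y) = sedge x y.

Definition cubic (G : sgraph) : Prop :=
  forall x : G, #|[pred y | sedge x y]| = 3.

(* Only paths between existing vertices are required, so the graph of order 0
   counts as connected. *)
Definition connected (G : sgraph) : Prop :=
  forall x y : G, connect (@sedge G) x y.

Section Automorphisms.

Variable G : sgraph.

Definition automorphisms : {set {perm G}} :=
  [set s : {perm G} | [forall x, forall y, sedge (s x) (s y) == sedge x y]].

Lemma automorphismsP (s : {perm G}) :
  reflect (forall x y, sedge (s x) (s y) = sedge x y) (s \in automorphisms).
Proof.
rewrite inE; apply: (iffP forallP) => h x; last by apply/forallP=> y; apply/eqP.
by move=> y; apply/eqP; move/forallP: (h x).
Qed.

Lemma automorphisms_group_set : group_set automorphisms.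
Proof.
apply/group_setP; split=> [|s t /automorphismsP hs /automorphismsP ht].
  by apply/automorphismsP=> x y; rewrite !perm1.
by apply/automorphismsP=> x y; rewrite !permM ht hs.
Qed.

Canonical automorphism_group : {group {perm G}} :=
  Group automorphisms_group_set.

Definition arcs : {set G * G} := [set a : G * G | sedge a.1 a.2].

Definition pair_act (a : G * G) (s : {perm G}) : G * G := (s a.1, s a.2).

Lemma pair_act1 : pair_act^~ 1%g =1 id.
Proof. by case=> x y; rewrite /pair_act /= !perm1. Qed.

Lemma pair_act_morph (a : G * G) : act_morph pair_act a.
Proof. by move=> s t; rewrite /pair_act /= !permM. Qed.

Canonical pair_action := TotalAction pair_act1 pair_act_morph.

Definition arc_transitive : Prop :=
  [transitive automorphisms, on arcs | pair_action].

End Automorphisms.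

Definition finitely_many_up_to_iso (P : sgraph -> Prop) : Prop :=
  exists (n : nat) (F : 'I_n -> sgraph),
    forall G, P G -> exists i, graph_iso G (F i).

Definition connected_symmetric_cubic_of_order_mul_prime (k : nat) (G : sgraph) : Prop :=
  [/\ connected G, cubic G, arc_transitive G &
      exists2 p, prime p & #|G| = k * p].

(* Main.v *)
Require Import Defs.
From mathcomp Require Import classical_sets cardinality.
From mathcomp Require Import all_boot all_fingroup all_solvable.
From mathcomp Require Import zify.

Set Implicit Arguments.
Unset Strict Implicit.
Unset Printing Implicit Defensive.

(** Let [G] be the automorphism group. Extending arcs as long as possible, [G] acts regularly
    on the arcs with [n] vertices for some [n]. As in Tutte's theorem, conjugating by a shunt
    the involution that fixes [n - 1] consecutive vertices and computing commutators of the
    conjugates gives [n <= 8], so vertex stabilisers have order at most [3 ^ 7].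

    If [|V| = 2 l p] and [p > 2 l 3 ^ 7], the Sylow [p]-subgroup [P] of [G] is then normal, of
    order [p]. Let [N = 'C_G(P)], which is [P] times a normal [p']-subgroup [Q], and contains
    the derived subgroup of [G].
    If some vertex stabiliser in [N] moves a neighbour, [Q] has at most two orbits, of equal
    length prime to [p], which is absurd. Otherwise [N] is semiregular, so vertex stabilisers
    are abelian, hence of order 3, and [G / P] has order [6 l] and is generated by an element
    [h] of order 3 and an involution [a]. As [l = 5] modulo 6, [h] centralises [N / P], whose
    order divides [2 l]; since [N / P] contains [[~ h, a]], [h] and [a] commute, so
    [|G / P| <= 6], a contradiction. *)

(** * Subgroups of index at most two, and a commutator identity *)

Section Commutators.
Local Open Scope group_scope.
Variables (gT : finGroupType) (H K : {group gT}).
Hypothesis sHK : H \subset K.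
Hypothesis mulHK : forall s t, s \in K -> t \in K -> s \notin H -> t \notin H -> s * t \in H.

(** If both [k] and [h ^ k] lie outside [H], then [h ^ k * k^-1 = k^-1 * h] lies in [H], which
    forces [k] into [H]. *)
Lemma index_two_conj h k : h \in H -> k \in K -> h ^ k \in H.
Proof.
move=> hH kK; have hK := subsetP sHK _ hH.
have [kH|kNH] := boolP (k \in H); first by rewrite groupJ.
apply/negPn/negP => hkNH.
have := mulHK (groupJ hK kK) (groupVr kK) hkNH.
rewrite groupV => /(_ kNH); rewrite conjgE -!mulgA mulgV mulg1 groupMr // groupV => kH.
by rewrite kH in kNH.
Qed.

Lemma index_two_comm s t : s \in K -> t \in K -> [~ s, t] \in H.
Proof.
move=> sK tK; have [sH|sNH] := boolP (s \in H).
  by rewrite commgEl groupM ?groupV ?index_two_conj.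
have [tH|tNH] := boolP (t \in H).
  by rewrite commgEr groupM ?index_two_conj ?groupV.
by rewrite commgEl conjgE !mulgA -mulgA groupM // mulHK ?groupV.
Qed.
(** Conjugation by [c] fixes [y] and multiplies [x] by [[~ x, c]], a factor that disappears from
    [[~ x, y]] because it commutes with both [y] and [[~ x, y]]. *)
Lemma commute_commg (x y c : gT) :
  commute y c -> commute y [~ x, c] -> commute [~ x, y] [~ x, c] -> commute [~ x, y] c.
Proof.
move=> yc yu wu; apply/commgP/conjg_fixP.
have xc : x ^ c = x * [~ x, c] by rewrite commgEl mulKVg.
have -> : [~ x, y] ^ c = [~ x * [~ x, c], y].
  by rewrite conjRg xc; congr [~ _, _]; apply/conjg_fixP/commgP.
rewrite commMgJ (conjg_fixP _) ?mulg1; last exact/commgP.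
by have /commgP/eqP -> : commute [~ x, c] y by []; rewrite mulg1.
Qed.
End Commutators.

(* [lia] is slow here on the membership hypotheses, which it treats as booleans. *)
Ltac index_lia :=
  repeat match goal with
  | H : is_true (in_mem _ _) |- _ => clear H
  | H : is_true (~~ _) |- _ => clear H
  end; lia.

(* Instantiated with [b i] the conjugate of an involution by [g ^+ i] and [A p q] the group
   generated by [b p, ..., b q.-1]. Let [mu] be the least distance at which two [b]'s fail
   to commute. Centrality forces [2 mu <= n]. The commutator of [b mu] and [b (2 mu)] lies in
   some [A i j.+1] with [mu < i <= j < 2 mu], minimal at both ends, and [commute_commg] applied
   at either end bounds [i] and [2 mu - j]. *)
Section Chain.
Local Open Scope group_scope.
Variables (gT : finGroupType) (n : nat) (A : nat -> nat -> {group gT}) (b : nat -> gT) (g : gT).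
Hypothesis b_shift : forall i, b i.+1 = b i ^ g.
Hypothesis A_nil : forall p, A p p = 1 :> {set gT}.
Hypothesis A_sub : forall p q p' q', p <= p' -> q' <= q -> A p' q' \subset A p q.
Hypothesis A_gen : forall p q r, p <= r -> r < q -> b r \in A p q.
Hypothesis A_capl : forall p q s, q < p + n -> s \in A p q -> s \in A p.+1 q.+1 -> s \in A p.+1 q.
(** Together with [A_sub], [A_left] and [A_right] say that dropping the generator at either end
    gives a subgroup of index at most 2, as long as the range is not too wide. *)
Hypothesis A_left : forall p q s t, q + 2 <= p + n -> s \in A p q -> t \in A p q ->
  s \notin A p.+1 q -> t \notin A p.+1 q -> s * t \in A p.+1 q.
Hypothesis A_right : forall p q s t, q + 3 <= p + n -> s \in A p q.+1 -> t \in A p q.+1 ->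
  s \notin A p q -> t \notin A p q -> s * t \in A p q.
Hypothesis b_left : forall p q, q + 2 <= p + n -> b p \notin A p.+1 q.
Hypothesis b_right : forall p q, q + 3 <= p + n -> b q \notin A p q.

Let b_shiftn i k : b (i + k) = b i ^ (g ^+ k).
Proof.
elim: k => [|k IH]; first by rewrite addn0 expg0 conjg1.
by rewrite addnS b_shift IH -conjgM -expgSr.
Qed.

Let comm_shift i j k : commute (b (i + k)) (b (j + k)) -> commute (b i) (b j).
Proof.
move/commgP; rewrite !b_shiftn -conjRg => /eqP h; apply/commgP.
by rewrite -(conjgK (g ^+ k) [~ b i, b j]) h conj1g.
Qed.

(** By [A_left], [s] is in [A p.+1 q] up to a factor [b p], so peeling off generators from the left
    reaches the trivial group. *)
Let cent_chain c p q s : q + 2 <= p + n ->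
  (forall r, p <= r -> r < q -> commute c (b r)) -> s \in A p q -> commute c s.
Proof.
move=> hq hc sA; have [k] := ubnP (q - p); elim: k => // k IH in p s hq hc sA *.
move=> hk; have [pq|qp] := ltnP p q; last first.
  by have /subsetP/(_ _ sA) := A_sub (leqnn p) qp; rewrite A_nil => /set1P->; apply: commute1.
have IHp t : t \in A p.+1 q -> commute c t.
  by move=> tA; apply: (IH p.+1) => // [|r ? ?|]; [lia|apply: hc => //; lia|lia].
have [sA'|sNA] := boolP (s \in A p.+1 q); first exact: IHp.
have bA := A_gen (leqnn p) pq.
have h := IHp _ (A_left hq sA bA sNA (b_left hq)).
have -> : s = s * b p * (b p)^-1 by rewrite mulgK.
by apply: commuteM h _; apply: commuteV; apply: hc.
Qed.

(** The commutator lies in both subgroups of index at most 2 obtained by dropping one end; [A_capl]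
    puts it in the range without both ends. *)
Let comm_chain p q s t : p < q -> q + 3 <= p + n -> s \in A p q.+1 -> t \in A p q.+1 ->
  [~ s, t] \in A p.+1 q.
Proof.
move=> pq hq sA tA; apply: A_capl; first by lia.
  apply: (index_two_comm _ _ sA tA); first exact: A_sub.
  by move=> x y xA yA; apply: A_right.
apply: (index_two_comm _ _ sA tA); first exact: A_sub.
by move=> x y xA yA; apply: A_left => //; lia.
Qed.

Hypothesis not_central : ~ (forall k, k < n -> commute (b n./2) (b k)).

Lemma chain_length : n <= 8.
Proof.
rewrite leqNgt; apply/negP => n_ge9.
have comm_near u : (forall d, d < u -> commute (b 0) (b d)) ->
    forall i j, i < j + u -> j < i + u -> commute (b i) (b j).
  move=> hu.
  suff hij i j : i <= j -> j < i + u -> commute (b i) (b j).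
    move=> i j hi hj; have [ij|/ltnW ji] := leqP i j; first exact: hij.
    exact/commute_sym/hij.
  move=> ij hj; rewrite -[i]add0n -(subnK ij) !b_shiftn /commute -!conjMg.
  by rewrite hu //; index_lia.
have exd : exists d, b 0 * b d != b d * b 0.
  have [/existsP[d]|] := boolP [exists d : 'I_n, b 0 * b d != b d * b 0]; first by exists d.
  rewrite negb_exists => /forallP hall; case: not_central => k kn.
  apply: (comm_near n); try index_lia.
  by move=> d dn; have := hall (Ordinal dn); rewrite negbK => /eqP.
have [mu mu_nc mu_min] := ex_minnP exd.
have mu_gt0 : 0 < mu by case: (mu) mu_nc => //; rewrite eqxx.
have near i j : i < j + mu -> j < i + mu -> commute (b i) (b j).
  apply: comm_near => d dmu; apply/eqP/negPn/negP => /mu_min; index_lia.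
have far i : ~ commute (b i) (b (i + mu)).
  by rewrite [i + mu]addnC -{1}[i]add0n => /comm_shift /eqP; apply/negP.
have mu_le : mu.*2 <= n.
  rewrite leqNgt; apply/negP => hmu; apply: not_central => k kn; apply: near; index_lia.
set w := [~ b mu, b mu.*2].
have w_neq1 : w != 1.
  apply/commgP => /eqP; rewrite -addnn; apply/negP/eqP/far.
have w_in : w \in A mu.+1 mu.*2.
  by apply: comm_chain; rewrite ?A_gen //; index_lia.
have exi : exists i, w \in A i mu.*2 by exists mu.+1.
have bnd_i i : w \in A i mu.*2 -> i <= mu.*2.
  move=> wi; rewrite leqNgt; apply/negP => hi.
  have := subsetP (A_sub (ltnW hi) (leqnn _)) _ wi.
  by rewrite A_nil inE (negPf w_neq1).
have [i wi i_max] := ex_maxnP exi bnd_i.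
have exj : exists j, w \in A i j.+1.
  by exists mu.*2.-1; rewrite prednK // double_gt0.
have [j wj j_min] := ex_minnP exj.
have i_gt : mu < i by apply: i_max.
have j_lt : j < mu.*2.
  by have := j_min mu.*2.-1; rewrite prednK ?double_gt0 // => /(_ wi); index_lia.
have wNi : w \notin A i.+1 j.+1.
  apply/negP => wi'; have /i_max : w \in A i.+1 mu.*2 by apply: subsetP wi'; apply: A_sub.
  index_lia.
have ij : i <= j.
  rewrite leqNgt; apply/negP => ji.
  have := subsetP (A_sub (leqnn i) ji) _ wj.
  by rewrite A_nil inE (negPf w_neq1).
have wNj : w \notin A i j.
  apply/negP; case: j ij wj j_min {j_lt wNi} => [|j'] ij wj j_min wj'; last first.
    by have := j_min _ wj'; index_lia.
  index_lia.
(* Otherwise [w] commutes with [b (i + mu)]. So does [w * b i], which lies in [A i.+1 j.+1] by the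
   maximality of [i]; hence so does [b i], contradicting [far]. *)
have bound_i : n <= i + 2.
  rewrite leqNgt; apply/negP => hi; set c := b (i + mu).
  have uA : [~ b mu, c] \in A mu.+1 (i + mu).
    by apply: comm_chain; rewrite ?A_gen //; index_lia.
  have wc : commute w c.
    apply: commute_commg.
    - by apply: near; index_lia.
    - by apply: cent_chain uA => [|r ? ?]; [index_lia | apply: near; index_lia].
    apply/commute_sym; apply: cent_chain wj => [|r ? ?]; first index_lia.
    by apply/commute_sym; apply: cent_chain uA => [|t ? ?]; [index_lia | apply: near; index_lia].
  apply: (far i); apply/commute_sym.
  have bA : b i \in A i j.+1 by apply: A_gen.
  have hq : j.+1 + 2 <= i + n by index_lia.
  have wbA := A_left hq wj bA wNi (b_left hq).
  have -> : b i = w^-1 * (w * b i) by rewrite mulKg.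
  apply: commuteM; first exact/commuteV/commute_sym.
  by apply: cent_chain wbA => [|r ? ?]; [index_lia | apply: near; index_lia].
(* The mirror image: otherwise [w] and [w * b j], the latter in [A i j] by the minimality of [j],
   commute with [b (j - mu)]. *)
have bound_j : n + j <= mu + mu.*2 + 2.
  rewrite leqNgt; apply/negP => hj; set c := b (j - mu).
  have uA : [~ b mu.*2, c] \in A (j - mu).+1 mu.*2.
    by apply: comm_chain; rewrite ?A_gen //; index_lia.
  have vc : commute [~ b mu.*2, b mu] c.
    apply: commute_commg.
    - by apply: near; index_lia.
    - by apply: cent_chain uA => [|r ? ?]; [index_lia | apply: near; index_lia].
    rewrite -invg_comm; apply/commute_sym/commuteV.
    apply: cent_chain wj => [|r ? ?]; first index_lia.
    by apply/commute_sym; apply: cent_chain uA => [|t ? ?]; [index_lia | apply: near; index_lia].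
  have wc : commute w c by rewrite /w -invg_comm; apply/commute_sym/commuteV/commute_sym.
  apply: (far (j - mu)); rewrite subnK; last index_lia.
  have bA : b j \in A i j.+1 by apply: A_gen.
  have hq : j + 3 <= i + n by index_lia.
  have wbA := A_right hq wj bA wNj (b_right hq).
  have -> : b j = w^-1 * (w * b j) by rewrite mulKg.
  apply: commuteM; first exact/commuteV/commute_sym.
  by apply: cent_chain wbA => [|r ? ?]; [index_lia | apply: near; index_lia].
(* From [n <= i + 2 <= j + 2] and [bound_j], [2 n <= 3 mu + 4]; with [2 mu <= n] this gives
   [n <= 8]. *)
index_lia.
Qed.
End Chain.

(** * Automorphisms of order 3, commutators and Sylow subgroups *)

Section GroupLemmas.
Local Open Scope group_scope.
Variable gT : finGroupType.
Implicit Types (G H K L M N P : {group gT}).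

Lemma card_cent1_mod3 K h : h \in 'N(K) -> h ^+ 3 = 1 -> #|K| = #|'C_K[h]| %[mod 3].
Proof.
move=> hK h3.
have p3 : 3.-group <[h]>.
  by rewrite /pgroup -orderE; apply: (@pnat_dvd _ 3); rewrite ?order_dvdn ?h3.
have act : [acts <[h]>, on K | 'J] by rewrite astabsJ cycle_subG.
by rewrite (pgroup_fix_mod p3 act) afixJ cent_cycle.
Qed.

Lemma prime_cent1 K h : prime #|K| -> #|K| != 1 %[mod 3] -> h \in 'N(K) -> h ^+ 3 = 1 ->
  K \subset 'C[h].
Proof.
move=> pr K1 hK h3; have K3 := card_cent1_mod3 hK h3.
have : #|'C_K[h]| %| #|K| by rewrite cardSg ?subsetIl.
case/(primeP pr).2/orP => /eqP cC; first by rewrite K3 cC eqxx in K1.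
by apply/setIidPl/eqP; rewrite eqEcard subsetIl cC leqnn.
Qed.

(** Neither 2 nor [l] is 1 modulo 3, so [prime_cent1] handles prime orders. In order [2 l] the Sylow
    [l]-subgroup has index 2, hence is normalised and so centralised by [h]; a centraliser of order
    exactly [l] would give [2 l = l] modulo 3. *)
Lemma cent1_dvd_double_prime M h l : prime l -> l = 5 %[mod 6] -> #|M| %| 2 * l ->
  h \in 'N(M) -> h ^+ 3 = 1 -> M \subset 'C[h].
Proof.
move=> prl l5 Ml hM h3; have l_gt2 : 2 < l by lia.
have [M_odd|M_even] := boolP (odd #|M|).
  have : #|M| %| l by move: Ml; rewrite Gauss_dvdr // coprimen2.
  case/(primeP prl).2/orP => /eqP cM.
    by rewrite (card1_trivg cM) sub1G.
  by apply: prime_cent1 => //; rewrite cM //; lia.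
have [m cM] : exists m, #|M| = (2 * m)%N by exists #|M|./2; lia.
move: Ml; rewrite cM dvdn_pmul2l // => /(primeP prl).2/orP[] /eqP em; rewrite {m}em in cM.
  by apply: prime_cent1; rewrite ?cM.
have [L sylL] := Sylow_exists l M.
have cL : #|L| = l.
  rewrite (card_Hall sylL) cM p_part lognM ?prime_gt0 // logn_prime //.
  rewrite (logn_prime l prl) eqxx; case: eqP => [e2|_]; [lia | by rewrite expn1].
have sLM := pHall_sub sylL.
have nLM : L <| M.
  by apply: index2_normal => //; rewrite -divgS // cM cL mulnK ?prime_gt0.
have hL : h \in 'N(L).
  rewrite -(normal_Hall_pcore sylL nLM); apply: subsetP hM.
  by apply: char_norms; apply: pcore_char.
have cLh : L \subset 'C_M[h].
  rewrite subsetI sLM prime_cent1 ?cL //; lia.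
have := card_cent1_mod3 hM h3; rewrite cM => eC.
have /dvdnP[c cC] : l %| #|'C_M[h]| by rewrite -cL cardSg.
have : #|'C_M[h]| %| 2 * l by rewrite -cM cardSg ?subsetIl.
rewrite cC dvdn_pmul2r ?prime_gt0 // => /(primeP (isT : prime 2)).2 c12.
apply/setIidPl/eqP; rewrite eqEcard subsetIl cM cC.
case/orP: c12 cC => /eqP -> // cC; move: eC; rewrite cC; clear - l5; lia.
Qed.

Lemma no_group_order_six_mul H M h a l : prime l -> l = 5 %[mod 6] -> #|H| = (6 * l)%N ->
  M <| H -> ~~ (3 %| #|M|) -> H :=: <<[set h; a]>> -> h ^+ 3 = 1 -> a ^+ 2 = 1 ->
  [~ h, a] \in M -> False.
Proof.
move=> prl l5 cH nMH M3 defH h3 a2 haM.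
have hH : h \in H by rewrite defH mem_gen // !inE eqxx.
have coM3 : coprime #|M| 3 by rewrite coprime_sym prime_coprime.
have Ml : #|M| %| 2 * l.
  rewrite -(Gauss_dvdr _ coM3) mulnA -cH; exact/cardSg/normal_sub.
have cMh : M \subset 'C[h].
  by apply: (cent1_dvd_double_prime prl) => //; apply: subsetP hH; apply: normal_norm.
have zh : commute h [~ h, a] by apply/commute_sym/cent1P/(subsetP cMh).
(* [h * [~ h, a]] is the conjugate [h ^ a], and its two factors commute. *)
have z3 : [~ h, a] ^+ 3 = 1.
  have : (h * [~ h, a]) ^+ 3 = 1 by rewrite commgEl mulKVg -conjXg h3 conj1g.
  by rewrite expgMn // h3 mul1g.
have z1 : [~ h, a] = 1.
  apply/eqP; rewrite -order_eq1 -dvdn1 -(eqnP coM3) dvdn_gcd order_dvdG //.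
  by rewrite order_dvdn z3 eqxx.
have cha : commute h a by apply/commgP; rewrite z1.
have defH' : H :=: <[h]> * <[a]>.
  have c : commute <[h]> <[a]>.
    by apply: centC; rewrite cycle_subG /= cent_cycle; apply/cent1P.
  by rewrite -(comm_joingE c) joing_idl joing_idr defH.
have : #|H| <= 6.
  rewrite defH'; apply: leq_trans (_ : #|<[h]>| * #|<[a]>| <= 6).
    by rewrite mul_cardG leq_pmulr ?cardG_gt0.
  rewrite (_ : 6 = 3 * 2)%N // leq_mul // -orderE dvdn_leq // order_dvdn; exact/eqP.
rewrite cH; have := prime_gt1 prl; lia.
Qed.

(** Conjugations act on a cyclic group as power maps, which commute with each other. *)
Lemma commg_cent_cyclic G P x y : cyclic P -> P <| G -> x \in G -> y \in G ->
  [~ x, y] \in 'C_G(P).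
Proof.
move=> /cyclicP[u defP] /normal_norm nPG xG yG; apply/setIP; split; first exact: groupR.
have pow g : g \in G -> exists i, u ^ g = u ^+ i.
  by move=> gG; apply/cycleP; rewrite -defP memJ_norm ?(subsetP nPG) // defP cycle_id.
have [i ui] := pow _ (groupVr xG); have [j uj] := pow _ (groupVr yG).
rewrite defP cent_cycle; apply/cent1P/commute_sym/commgP/conjg_fixP.
have comm : u ^ (x^-1 * y^-1) = u ^ (y^-1 * x^-1).
  by rewrite !conjgM ui uj !conjXg ui uj -!expgM mulnC.
by rewrite commgEl conjgE !mulgA -mulgA conjgM comm -conjgM -invMg mulVg conjg1.
Qed.

(** The number of Sylow [p]-subgroups is 1 modulo [p] and at most [k < p]. *)
Lemma Sylow_normal_small_index G P p k : prime p -> #|G| = (p * k)%N -> k < p -> p.-Sylow(G) P ->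
  P <| G /\ #|P| = p.
Proof.
move=> prp cG kp sylP; have k0 : 0 < k by have := cardG_gt0 G; rewrite cG; case: k {cG kp}; rewrite ?muln0.
have cP : #|P| = p.
  rewrite (card_Hall sylP) cG p_part lognM ?(prime_gt0 prp) // logn_prime // eqxx.
  by rewrite (lognE p k) gtnNdvd // !andbF.
split=> //; have := card_Syl_mod G prp; rewrite (card_Syl sylP) => idx1.
have idx : #|G : 'N_G(P)| < p.
  have PN : P \subset 'N_G(P) by rewrite subsetI (pHall_sub sylP) normG.
  have := Lagrange (subsetIl G 'N(P)).
  rewrite -(Lagrange PN) cP cG -mulnA => /eqP; rewrite eqn_pmul2l ?prime_gt0 // => /eqP kE.
  by apply: leq_ltn_trans kp; rewrite -kE leq_pmull // indexg_gt0.
rewrite modn_small // in idx1.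
rewrite /normal (pHall_sub sylP); apply/setIidPl/eqP.
by rewrite eqEsubset subsetIl -indexg_eq1 idx1.
Qed.

(** A Schur-Zassenhaus complement of [P] is centralised by [P], hence normal in [N]. *)
Lemma central_Sylow_pcore N P p : p.-Sylow(N) P -> N \subset 'C(P) -> p^'.-Hall(N) 'O_p^'(N).
Proof.
move=> sylP cNP; have sPN := pHall_sub sylP.
have nPN : P <| N by rewrite /normal sPN cents_norm.
have /splitsP[Q complQ] := SchurZassenhaus_split (pHall_Hall sylP) nPN.
have hallQ : p^'.-Hall(N) Q by rewrite -(compl_pHall Q sylP).
have [_ defN] := complP complQ.
suff nQN : Q <| N by rewrite (normal_Hall_pcore hallQ nQN).
rewrite /normal (pHall_sub hallQ) -defN mul_subG ?normG // cents_norm // centsC.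
exact: subset_trans (pHall_sub hallQ) cNP.
Qed.
End GroupLemmas.

(** * Arc-transitive groups on connected cubic graphs: neighbours, arcs and their stabilisers *)

Section CubicGraph.
Local Open Scope group_scope.
Variables (V : finType) (e : rel V) (G : {group {perm V}}).
Hypothesis e_sym : symmetric e.
Hypothesis e_cubic : forall v, #|[pred y | e v y]| = 3.
Hypothesis e_conn : forall u v, connect e u v.
Hypothesis G_aut : forall s, s \in G -> forall u v, e (s u) (s v) = e u v.
Hypothesis G_arc : forall u v u' v', e u v -> e u' v' ->
  exists2 s, s \in G & s u = u' /\ s v = v'.

Lemma nbr_avoid v c d : exists y, [/\ e v y, y != c & y != d].
Proof.
have [/existsP[y /and3P[? ? ?]]|] := boolP [exists y, [&& e v y, y != c & y != d]]; first by exists y.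
rewrite negb_exists => /forallP h.
suff /subset_leq_card : [pred y | e v y] \subset [set c; d].
  by rewrite e_cubic cards2; case: eqP.
apply/subsetP => y; rewrite !inE => ey; have := h y; rewrite ey /=.
by rewrite negb_and !negbK.
Qed.

Lemma nbr_third v a c d f : e v a -> e v c -> e v d -> e v f ->
  a != c -> a != d -> c != d -> f != a -> f != c -> f = d.
Proof.
move=> va vc vd vf ac ad cd fa fc; apply/eqP/negPn/negP => fd.
have u : uniq [:: f; a; c; d] by rewrite /= !inE !negb_or fa fc fd ac ad cd.
have: {subset [:: f; a; c; d] <= enum [pred y | e v y]}.
  by move=> y; rewrite !inE mem_enum inE => /or4P[] /eqP->.
by move/(uniq_leq_size u); rewrite -cardE e_cubic.
Qed.

Lemma nbr_closed (S : V -> Prop) v : S v -> (forall u w, S u -> e u w -> S w) ->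
  forall w, S w.
Proof.
move=> Sv Scl w; have /connectP[p vp ->] := e_conn v w.
by elim: p v Sv vp => //= u p IH v Sv /andP[vu up]; apply: IH up; apply: Scl vu.
Qed.

(* [n] counts vertices, not edges. *)
Definition arc n (x : nat -> V) :=
  (forall i, i.+1 < n -> e (x i) (x i.+1)) /\ (forall i, i.+2 < n -> x i != x i.+2).

Definition pointstab (x : nat -> V) p q : {group {perm V}} :=
  'C_G([set x i | i : 'I_q & p <= i] | 'P)%G.

Lemma pointstabP x p q s :
  reflect (s \in G /\ forall i, p <= i -> i < q -> s (x i) = x i) (s \in pointstab x p q).
Proof.
apply: (iffP setIP) => [[sG /astabP h]|[sG h]]; split=> //.
  by move=> i pi iq; apply: (h (x i)); apply/imsetP; exists (Ordinal iq); rewrite ?inE.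
by apply/astabP => _ /imsetP[i] /[!inE] pi ->; apply: h.
Qed.

Lemma arc_sub m n x : m <= n -> arc n x -> arc m x.
Proof.
by move=> mn [h1 h2]; split=> i im; [apply: h1 | apply: h2]; apply: leq_trans mn.
Qed.

Definition snoc n (x : nat -> V) y i := if i < n then x i else y.

Lemma arc_snoc n x y : arc n.+2 x -> e (x n.+1) y -> y != x n -> arc n.+3 (snoc n.+2 x y).
Proof.
move=> [h1 h2] xy yx; split=> i im; rewrite /snoc.
  have -> : i < n.+2 by lia.
  case: ltnP => [?|ni]; first exact: h1.
  by have -> : i = n.+1 by lia.
have -> : i < n.+2 by lia.
case: ltnP => [?|ni]; first exact: h2.
have -> : i = n by lia.
by rewrite eq_sym.
Qed.

Definition cons_seq (x : nat -> V) y i := if i is j.+1 then x j else y.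

Lemma arc_cons n x y : arc n x -> e (x 0) y -> y != x 1%N -> arc n.+1 (cons_seq x y).
Proof.
move=> [h1 h2] xy yx; split=> -[|i] im //=; last exact: h2.
  by rewrite e_sym.
exact: h1.
Qed.

Lemma arc_shift n x k : arc (n + k) x -> arc n (fun i => x (i + k)).
Proof.
by move=> [h1 h2]; split=> i im; [apply: (h1 (i + k)) | apply: (h2 (i + k))]; lia.
Qed.

(** For positive [n], this is [(n - 1)]-arc-transitivity in Tutte's sense. *)
Definition ntransitive n := forall x y, arc n x -> arc n y ->
  exists2 s, s \in G & forall i, i < n -> s (x i) = y i.

Lemma ntransitive2 : ntransitive 2.
Proof.
move=> x y [ax _] [ay _]; have [s sG [s0 s1]] := G_arc (ax 0 isT) (ay 0 isT).
by exists s => // -[|[|]].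
Qed.

Lemma card_pointstab n x y p q : q <= n -> ntransitive n -> arc n x -> arc n y ->
  #|pointstab x p q| = #|pointstab y p q|.
Proof.
move=> qn Tn ax ay; have [g gG gx] := Tn _ _ ax ay.
rewrite -(cardJg (pointstab x p q) g); apply: eq_card => s.
rewrite mem_conjg; apply/pointstabP/pointstabP => -[sG h]; split=> [|i pi iq].
- by rewrite -(groupJr s (groupVr gG)).
- have := h i pi iq; rewrite conjgE invgK !permM -gx; last exact: leq_trans iq qn.
  by move/(congr1 g); rewrite permKV.
- by rewrite groupJr ?groupV.
- rewrite conjgE invgK !permM gx; last exact: leq_trans iq qn.
  by rewrite h // -gx ?permK //; apply: leq_trans iq qn.
Qed.

(* Otherwise the stabiliser of an arc is unchanged when the arc is shifted in either
   direction, hence fixes every vertex. *)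
Lemma pointstab_moves n x : ntransitive n.+2 -> arc n.+2 x -> pointstab x 0 n.+2 :!=: 1 ->
  exists s y, [/\ s \in pointstab x 0 n.+2, e (x n.+1) y & s y != y].
Proof.
move=> Tn ax Wx; have [/existsP[s /andP[sW /existsP[y /andP[xy sy]]]]|] :=
  boolP [exists s in pointstab x 0 n.+2, [exists y, e (x n.+1) y && (s y != y)]]; first by exists s, y.
rewrite negb_exists_in => /forall_inP hx; case/eqP: Wx.
have {}hx s y : s \in pointstab x 0 n.+2 -> e (x n.+1) y -> s y = y.
  move=> /hx; rewrite negb_exists => /forallP/(_ y) + xy.
  by rewrite xy /= negbK => /eqP.
have fixn y z s : arc n.+2 y -> s \in pointstab y 0 n.+2 -> e (y n.+1) z -> s z = z.
  move=> ay /pointstabP[sG sW] yz; have [g gG gx] := Tn _ _ ay ax.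
  have sgW : s ^ g \in pointstab x 0 n.+2.
    apply/pointstabP; split=> [|i _ i_n]; first by rewrite groupJ.
    by rewrite conjgE !permM -gx // permK sW.
  have := hx _ (g z) sgW; rewrite -gx // G_aut // => /(_ yz).
  by rewrite conjgE !permM permK => /perm_inj.
have shift y z : arc n.+2 y -> arc n.+2 z -> (forall i, i < n.+1 -> z i = y i.+1) ->
    pointstab z 0 n.+2 = pointstab y 0 n.+2.
  move=> ay az zy; apply/group_inj/eqP; rewrite eq_sym eqEcard.
  rewrite (card_pointstab 0 (leqnn _) Tn ay az) leqnn andbT; apply/subsetP => s sW.
  have /pointstabP[sG sy] := sW.
  apply/pointstabP; split=> // i _ i_n; have [i_n'|n_i] := ltnP i n.+1.
    by rewrite zy // sy //; lia.
  have -> : i = n.+1 by lia.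
  by apply: fixn ay sW _; rewrite -zy //; have [/(_ n) az' _] := az; apply: az'.
pose S u := exists y, [/\ arc n.+2 y, pointstab y 0 n.+2 = pointstab x 0 n.+2 & u = y 0].
have S_all : forall u, S u.
  apply: (@nbr_closed S (x 0)); first by exists x.
  move=> u w [y [ay yx ->]] yw.
  have [wy|wNy] := eqVneq w (y 1%N).
    have [z [yz zy _]] := nbr_avoid (y n.+1) (y n) (y n).
    have az := arc_snoc ay yz zy.
    exists (fun i => snoc n.+2 y z (i + 1)); split.
    - by apply: arc_shift; rewrite addn1.
    - rewrite -yx; apply: shift => //; first by apply: arc_shift; rewrite addn1.
      by move=> i i_n; rewrite /snoc addn1 ltnS i_n.
    - by rewrite /snoc add0n.
  have ac := arc_cons ay yw wNy.
  exists (cons_seq y w); split=> //; first exact: arc_sub ac.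
  by rewrite -yx; apply/esym/shift => //; apply: arc_sub ac.
apply/trivgP/subsetP => s sW; apply/set1P/permP => u; rewrite perm1.
by have [y [_ yx ->]] := S_all u; move: sW; rewrite -yx => /pointstabP[_ ->].
Qed.

(** Some element fixing the first [n.+2] vertices swaps the two possible continuations of the arc,
    so an element matching these vertices can be corrected to match the last one too. *)
Lemma ntransitiveS n x : ntransitive n.+2 -> arc n.+2 x -> pointstab x 0 n.+2 :!=: 1 ->
  ntransitive n.+3.
Proof.
move=> Tn ax Wx y z ay az.
have az' := arc_sub (leqnSn _) az.
have Wz : pointstab z 0 n.+2 :!=: 1.
  by rewrite -cardG_gt1 (card_pointstab 0 (leqnn _) Tn az' ax) cardG_gt1.
have [g gG gy] := Tn _ _ (arc_sub (leqnSn _) ay) az'.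
have [s [w [/pointstabP[sG sz] zw sw]]] := pointstab_moves Tn az' Wz.
have [h1 h2] := az; have [h1' h2'] := ay.
have z1 : e (z n.+1) (z n) by rewrite e_sym h1.
have z2 : e (z n.+1) (z n.+2) by rewrite h1.
have y2 : e (z n.+1) (g (y n.+2)) by rewrite -gy // G_aut ?h1'.
have y3 : g (y n.+2) != z n by rewrite -gy // (inj_eq perm_inj) eq_sym h2'.
have z3 : z n != z n.+2 by rewrite h2.
have [yz|yNz] := eqVneq (g (y n.+2)) (z n.+2).
  exists g => // i; rewrite ltnS leq_eqVlt => /predU1P[->|] //; exact: gy.
have sn : s (z n) = z n by rewrite sz.
have es u : e (z n.+1) u -> e (z n.+1) (s u) by rewrite -{2}(sz n.+1) // G_aut.
have sNn u : (s u != z n) = (u != z n) by rewrite -{1}sn (inj_eq perm_inj).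
have wn : w != z n by apply: contraNneq sw => ->; rewrite sn.
exists (g * s) => [|i]; first exact: groupM.
rewrite ltnS permM leq_eqVlt => /predU1P[->|i_n]; last by rewrite gy ?sz.
apply: (nbr_third z1 y2 z2 (es _ y2)) => //; rewrite ?sNn // 1?eq_sym //.
have [wy|wy] := eqVneq w (g (y n.+2)); first by rewrite eq_sym -wy.
have wz : w = z n.+2.
  by apply: (nbr_third z1 y2 z2 zw) => //; rewrite eq_sym.
apply: contraNneq sw => sy; apply/eqP; rewrite wz.
apply: (nbr_third z1 y2 z2 (es _ z2)) => //; rewrite ?sNn // 1?eq_sym //.
by rewrite sy (inj_eq perm_inj) // eq_sym.
Qed.

Lemma last_moved n x : ntransitive n.+3 -> arc n.+3 x ->
  exists2 s, s \in pointstab x 0 n.+2 & s (x n.+2) != x n.+2.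
Proof.
move=> Tn ax; have [z [xz zx zN]] := nbr_avoid (x n.+1) (x n) (x n.+2).
have [s sG sx] := Tn _ _ ax (arc_snoc (arc_sub (leqnSn _) ax) xz zx).
exists s; last by rewrite sx // /snoc ltnn.
by apply/pointstabP; split=> // i _ i_n; rewrite sx /snoc ?i_n //; apply: ltnW.
Qed.

(** While the stabiliser of an arc is nontrivial, transitivity extends to arcs with one more vertex,
    whose stabiliser is strictly smaller by [last_moved]. *)
Lemma ex_ntransitive_triv (v0 : V) :
  exists n x, [/\ ntransitive n.+2, arc n.+2 x & pointstab x 0 n.+2 :=: 1].
Proof.
suff ind k n x : #|pointstab x 0 n.+2| < k -> ntransitive n.+2 -> arc n.+2 x ->
    exists n x, [/\ ntransitive n.+2, arc n.+2 x & pointstab x 0 n.+2 :=: 1].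
  have [w [vw _ _]] := nbr_avoid v0 v0 v0.
  apply: (ind _ 0 (fun i => if i is 0 then v0 else w) (ltnSn _) ntransitive2).
  by split=> [[|i]|i] // i_n; lia.
elim: k n x => // k IH n x Wk Tn ax.
have [W1|WN] := eqVneq (pointstab x 0 n.+2 : {set _}) 1; first by exists n, x.
have T3 := ntransitiveS Tn ax WN.
have [y [xy yx _]] := nbr_avoid (x n.+1) (x n) (x n).
have ay := arc_snoc ax xy yx; apply: (IH n.+1 _ _ T3 ay).
have [s /pointstabP[sG sW] sN] := last_moved T3 ay.
apply: leq_trans (Wk : _ <= k); apply: proper_card; apply/properP; split.
  apply/subsetP => t /pointstabP[tG tW]; apply/pointstabP; split=> // i _ i_n.
  by have := tW i isT (ltnW i_n : i < n.+3); rewrite /snoc i_n.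
exists s; last by apply/pointstabP => -[_ /(_ n.+2 isT (ltnSn _))]; apply/eqP.
by apply/pointstabP; split=> // i _ i_n; have := sW i isT i_n; rewrite /snoc i_n.
Qed.

(** * Tutte's bound and the order of vertex stabilisers *)

Lemma two_moves s t u a c : s \in G -> t \in G -> s u = u -> t u = u -> s a = a -> t a = a ->
  e u a -> e u c -> a != c -> s c != c -> t c != c -> (s * t) c = c.
Proof.
move=> sG tG su tu sa ta ua uc ac sc tc; rewrite permM.
have tN y : (t y != a) = (y != a) by rewrite -{1}ta (inj_eq perm_inj).
have sN y : (s y != a) = (y != a) by rewrite -{1}sa (inj_eq perm_inj).
have et y : e u (t y) = e u y by rewrite -{1}tu G_aut.
have es y : e u (s y) = e u y by rewrite -{1}su G_aut.
(* Both [s] and [t] swap the two neighbours of [u] other than [a]. *)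
apply: (@nbr_third u a (t c)); rewrite ?et ?es ?tN ?sN ?(inj_eq perm_inj) //.
  by rewrite eq_sym tN eq_sym.
by rewrite eq_sym.
Qed.

(** The third neighbour of [u] is both [s c] and [t a], so [c] is carried to it by [s] and to [a] by
    [s * t^-1]. *)
Lemma nbr_orbit (K : {group {perm V}}) s t u a c : K \subset G -> s \in K -> t \in K ->
  s u = u -> t u = u -> s a = a -> t c = c -> s c != c -> t a != a ->
  e u a -> e u c -> forall y, e u y -> exists2 h, h \in K & y = h c.
Proof.
move=> /subsetP KG sK tK su tu sa tc sc ta ua uc y uy.
have ac : a != c by apply: contraNneq sc => <-; rewrite sa.
have sN v : (s v != a) = (v != a) by rewrite -{1}sa (inj_eq perm_inj).
have tN v : (t v != c) = (v != c) by rewrite -{1}tc (inj_eq perm_inj).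
have es v : e u (s v) = e u v by rewrite -{1}su G_aut ?KG.
have et v : e u (t v) = e u v by rewrite -{1}tu G_aut ?KG.
have third v : e u v -> v != a -> v != c -> v = s c.
  move=> uv va vc; apply: (@nbr_third u a c); rewrite ?es // eq_sym //.
  by rewrite sN eq_sym.
have [->|yc] := eqVneq y c; first by exists 1; rewrite ?group1 ?perm1.
have [->|ya] := eqVneq y a; last by exists s => //; apply: third.
exists (s * t^-1); first by rewrite groupM ?groupV.
by rewrite permM -(third (t a)) ?et ?tN // permK.
Qed.

(** Take [g] shifting an arc one step along an extension of it, and iterate. The walk [z] may
    revisit vertices: [arc] only forbids immediate backtracking. *)
Lemma ex_shunt n x : ntransitive n.+2 -> arc n.+2 x ->
  exists g z, [/\ g \in G, forall i, z i.+1 = g (z i) & forall k, arc k z].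
Proof.
move=> Tn ax; have [w [xw wx _]] := nbr_avoid (x n.+1) (x n) (x n).
have := arc_snoc ax xw wx; move: (snoc _ _ _) => y ay.
have [g gG gy] := Tn _ _ (arc_sub (leqnSn _) ay) (arc_shift (x := y) (n := n.+2) (k := 1) ltac:(by rewrite addn1)).
pose z i := iter i g (y 0); exists g, z; split=> // k.
have zy i : i < n.+3 -> z i = y i.
  by elim: i => // i IH i_n; rewrite /z iterS -/(z i) IH 1?ltnW // gy // addn1.
have [y1 y2] := ay.
split=> i _.
  by elim: i => [|i IH]; [rewrite !zy ?y1 | rewrite /z !iterS G_aut].
elim: i => [|i IH]; last by rewrite /z !iterS (inj_eq perm_inj).
by rewrite !zy ?y2.
Qed.

Lemma ntransitive_length n x : ntransitive n.+2 -> arc n.+2 x -> pointstab x 0 n.+2 :=: 1 ->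
  n.+2 <= 8.
Proof.
move=> Tn ax Wx; rewrite leqNgt; apply/negP => n_ge.
have [g [z [gG zS az]]] := ex_shunt Tn ax.
have zg k i : z (i + k) = (g ^+ k) (z i).
  by elim: k => [|k IH]; rewrite ?addn0 ?expg0 ?perm1 // addnS zS IH expgSr permM.
have Wtriv p s : s \in pointstab z p (p + n.+2) -> s = 1.
  move=> /pointstabP[sG sz].
  have az' : arc n.+2 (fun i => z (i + p)) by exact: arc_shift.
  have W1 : pointstab (fun i => z (i + p)) 0 n.+2 :=: 1.
    by apply/eqP; rewrite trivg_card1 (card_pointstab 0 (leqnn _) Tn az' ax) Wx cards1.
  suff : s \in pointstab (fun i => z (i + p)) 0 n.+2 by rewrite W1 => /set1P.
  apply/pointstabP; split=> // i _ i_n.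
  by rewrite sz // ?leq_addl // addnC ltn_add2l.
have [b0 [b0G b0fix b0n]] : exists b0, [/\ b0 \in G,
    forall i, 0 < i -> i < n.+2 -> b0 (z i) = z i & b0 (z n.+2) != z n.+2].
  case: n n_ge Tn {ax Wx Wtriv} => // n n_ge Tn.
  have [s /pointstabP[sG sz] sN] := last_moved Tn (arc_shift (k := 1) (az _)).
  exists s; split=> // [i i0 i_n|]; last by rewrite addn1 in sN.
  by have := sz i.-1 isT; rewrite addn1 prednK // => ->.
(* Otherwise [b0] would fix [n.+2] consecutive vertices and be trivial. *)
have b00 : b0 (z 0) != z 0.
  apply: contraNneq b0n => b00; rewrite (Wtriv 0 b0) ?perm1 //.
  by apply/pointstabP; split=> // -[|i] _ //; apply: b0fix.
pose b i := b0 ^ (g ^+ i).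
have bz k i : b k (z (i + k)) = (g ^+ k) (b0 (z i)).
  by rewrite zg /b conjgE !permM permK.
have bG k : b k \in G by rewrite /b groupJ ?groupX.
have bfix k i : k < i -> i < k + n.+2 -> b k (z i) = z i.
  move=> ki ik; rewrite -(subnK (ltnW ki)) bz b0fix -?zg //; index_lia.
have bl k : b k (z k) != z k.
  by rewrite -[k in z k]add0n bz zg (inj_eq perm_inj).
have br k : b k (z (k + n.+2)) != z (k + n.+2).
  by rewrite addnC bz zg (inj_eq perm_inj).
have zadj i : e (z i) (z i.+1) by have [h _] := az i.+2; apply: h.
have zadj' i : e (z i.+1) (z i) by rewrite e_sym.
have zneq i : z i != z i.+2 by have [_ h] := az i.+3; apply: h.
suff : n.+2 <= 8 by index_lia.
(* As [b r] fixes [z r.+1, ..., z (r + n.+1)] and moves both vertices just outside, the vertices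
   fixed by all of [b p, ..., b q.-1] include [z q, ..., z (p + n.+1)]; [A p q] is the stabiliser of
   these. *)
apply: (@chain_length _ n.+2 (fun p q => pointstab z q (p + n.+2)) b g).
- by move=> i; rewrite /b -conjgM expgSr.
- move=> p; apply/trivgP/subsetP => s /Wtriv ->; exact: set11.
- move=> p q p' q' pp qq; apply/subsetP => s /pointstabP[sG h].
  by apply/pointstabP; split=> // i qi ip; apply: h; index_lia.
- move=> p q r pr rq; apply/pointstabP; split=> // i qi ip; apply: bfix; index_lia.
- move=> p q s qp /pointstabP[sG h1] /pointstabP[_ h2]; apply/pointstabP; split=> // i qi ip.
  by have [iq|iq] := ltnP q i; [apply: h2 | apply: h1]; index_lia.
- move=> p q s t hq /pointstabP[sG sz] /pointstabP[tG tz] sN tN.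
  have mv r : r \in G -> (forall i, q <= i -> i < p + n.+2 -> r (z i) = z i) ->
      r \notin pointstab z q (p.+1 + n.+2) -> r (z (p + n.+2)) != z (p + n.+2).
    move=> rG rz; apply: contraNneq => r0; apply/pointstabP; split=> // i qi ip.
    by have [->//|/eqP ni] := eqVneq i (p + n.+2); apply: rz => //; index_lia.
  apply/pointstabP; split=> [|i qi ip]; first exact: groupM.
  have [->|/eqP ni] := eqVneq i (p + n.+2); last by rewrite permM sz ?tz //; index_lia.
  have sm := mv s sG sz sN; have tm := mv t tG tz tN; rewrite !addnS in sz tz sm tm *.
  have [q1 q2 q3 q4] : [/\ q <= (p + n).+1, (p + n).+1 < (p + n).+2, q <= p + n & p + n < (p + n).+2].
    by split; clear - hq; lia.
  exact: (two_moves sG tG (sz _ q1 q2) (tz _ q1 q2) (sz _ q3 q4) (tz _ q3 q4)).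
- move=> p q s t hq /pointstabP[sG sz] /pointstabP[tG tz] sN tN.
  have mv r : r \in G -> (forall i, q < i -> i < p + n.+2 -> r (z i) = z i) ->
      r \notin pointstab z q (p + n.+2) -> r (z q) != z q.
    move=> rG rz; apply: contraNneq => r0; apply/pointstabP; split=> // i qi ip.
    by have [->//|/eqP ni] := eqVneq i q; apply: rz => //; index_lia.
  apply/pointstabP; split=> [|i qi ip]; first exact: groupM.
  have [->|/eqP ni] := eqVneq i q; last by rewrite permM sz ?tz //; index_lia.
  have sm := mv s sG sz sN; have tm := mv t tG tz tN.
  have [q1 q2] : q.+1 < p + n.+2 /\ q.+2 < p + n.+2 by clear - hq; lia.
  apply: (two_moves sG tG _ _ (sz _ _ q2) (tz _ _ q2)) => //; first exact: sz.
    exact: tz.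
  by rewrite eq_sym.
- move=> p q hq; apply/pointstabP => -[_ /(_ (p + n.+2))]; rewrite ltnS leqnn => h.
  by case/eqP: (br p); apply: h => //; index_lia.
- move=> p q hq; apply/pointstabP => -[_ /(_ q)] h.
  by case/eqP: (bl q); apply: h => //; index_lia.
(* If [b m] were central, its centraliser [K] would be transitive on the neighbours of [z n.+1]
   (using [b 0] and [b n]) and of [z n.+2] (using [b n.+1] and [b 1]). The [K]-images of these two
   vertices then cover the graph, and [b m] fixes them all, yet it moves [z m]. *)
set m := n.+2./2 => cm; have mn : 0 < m < n.+1 by index_lia.
pose K := 'C_G[b m]%G.
have KP r : r < n.+2 -> b r \in K.
  by move=> rn; apply/setIP; split=> //; apply/cent1P/commute_sym/cm.
pose S u := exists2 k, k \in K & u = k (z n.+1) \/ u = k (z n.+2).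
have nbr1 y : e (z n.+1) y -> exists2 h, h \in K & y = h (z n.+2).
  apply: (nbr_orbit _ _ _ _ _ _ _ (br 0) (bl n) (zadj' n) (zadj n.+1)) => //; first exact: subsetIl.
  - exact: KP.
  - apply: KP; index_lia.
  - apply: bfix; index_lia.
  - apply: bfix; index_lia.
  - apply: bfix; index_lia.
  - apply: bfix; index_lia.
have nbr2 y : e (z n.+2) y -> exists2 h, h \in K & y = h (z n.+1).
  apply: (nbr_orbit _ _ _ _ _ _ _ (bl n.+1) (br 1%N) (zadj n.+2) (zadj' n.+1)) => //; first exact: subsetIl.
  - exact: KP.
  - apply: KP; index_lia.
  - apply: bfix; index_lia.
  - apply: bfix; index_lia.
  - apply: bfix; index_lia.
  - apply: bfix; index_lia.
have Sall : forall u, S u.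
  apply: (@nbr_closed S (z n.+1)); first by exists 1; rewrite ?group1 ?perm1 //; left.
  move=> u w [k kK uk] uw; have kG : k \in G by case/setIP: kK.
  have wk : w = k (k^-1 w) by rewrite permKV.
  case: uk uw => ->; rewrite {1}wk G_aut //; [move/nbr1 | move/nbr2] => -[h hK hw].
    by exists (h * k); [exact: groupM | right; rewrite permM -hw -wk].
  by exists (h * k); [exact: groupM | left; rewrite permM -hw -wk].
case/eqP: (bl m); have [k /setIP[kG /cent1P kb] [] ->] := Sall (z m).
  by rewrite -permM kb permM bfix //; index_lia.
by rewrite -permM kb permM bfix //; index_lia.
Qed.

Lemma card_arcstab n x : arc n.+1 x -> #|pointstab x 0 1| <= 3 ^ n * #|pointstab x 0 n.+1|.
Proof.
elim: n => [|n IH] ax; first by rewrite mul1n.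
apply: leq_trans (IH (arc_sub (leqnSn _) ax)) _.
rewrite expnSr -mulnA leq_mul2l orbC; apply/orP; left.
have -> : pointstab x 0 n.+2 = 'C_(pointstab x 0 n.+1)[x n.+1 | 'P]%G.
  apply/group_inj/setP => s; apply/pointstabP/setIP.
    move=> [sG sx]; split; last by apply/astab1P; apply: sx.
    by apply/pointstabP; split=> // i _ i_n; apply: sx => //; apply: ltnW.
  move=> [/pointstabP[sG sx] /astab1P sn]; split=> // i _.
  by rewrite ltnS leq_eqVlt => /predU1P[->|] //; apply: sx.
(* The next vertex stays among the three neighbours of the fixed vertex [x n]. *)
rewrite -(card_orbit_stab 'P (pointstab x 0 n.+1) (x n.+1)) leq_mul2r; apply/orP; right.
rewrite -(e_cubic (x n)); apply: subset_leq_card; apply/subsetP => _ /orbitP[s /pointstabP[sG sx] <-].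
have [h _] := ax.
by rewrite inE /= -{1}(sx n) // G_aut // h.
Qed.

Lemma card_aut_le (v0 : V) : #|G| <= #|V| * 3 ^ 7.
Proof.
have [n [x [Tn ax Wx]]] := ex_ntransitive_triv v0.
have n8 := ntransitive_length Tn ax Wx.
have := card_arcstab ax; rewrite Wx cards1 muln1 => hW.
have -> : #|G| = (#|orbit 'P G (x 0)| * #|pointstab x 0 1|)%N.
  rewrite -(card_orbit_stab 'P G (x 0)); congr (_ * _)%N; apply: eq_card => s.
  apply/setIP/pointstabP => -[sG]; first by move/astab1P => sx; split=> // -[].
  by move=> sx; split=> //; apply/astab1P/sx.
apply: leq_mul; first exact: max_card.
(* An arc with at most 8 vertices contributes at most 7 factors 3 after its first vertex. *)
apply: leq_trans hW _; rewrite leq_exp2l //; lia.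
Qed.

(** * Vertex orbits, normal subgroups and abelian stabilisers *)

Lemma vertex_transitive u v : exists2 s, s \in G & s u = v.
Proof.
have [w [uw _ _]] := nbr_avoid u u u; have [y [vy _ _]] := nbr_avoid v v v.
by have [s sG [su _]] := G_arc uw vy; exists s.
Qed.

Lemma card_aut_vertex v : #|G| = (#|V| * #|'C_G[v | 'P]|)%N.
Proof.
rewrite -(card_orbit_stab 'P G v); congr (_ * _)%N; rewrite -cardsT; apply: eq_card => u.
rewrite inE; apply/orbitP; have [s sG su] := vertex_transitive v u.
by exists s.
Qed.

Definition semiregular (N : {group {perm V}}) := forall s v, s \in N -> s v = v -> s = 1.

(** If no element of [N] moves a neighbour of a vertex it fixes, fixed points spread along edges.
    Otherwise conjugation in [G] shows that each vertex stabiliser in [N] moves each of the three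
    neighbours, and a group on three points with no common fixed point is transitive. *)
Lemma normal_semiregular_or_local (N : {group {perm V}}) : N <| G ->
  semiregular N \/
  forall v y y', e v y -> e v y' -> exists t, [/\ t \in N, t v = v & t y = y'].
Proof.
move=> nNG; have NG := subsetP (normal_sub nNG).
have [loc|] := boolP [exists s in N, [exists v, (s v == v) && [exists y, e v y && (s y != y)]]];
  last first.
  rewrite negb_exists_in => /forall_inP fixN; left=> s v sN sv.
  have {}fixN u w : s u = u -> e u w -> s w = w.
    have := fixN s sN; rewrite negb_exists => /forallP/(_ u) + su; rewrite su eqxx /=.
    by rewrite negb_exists => /forallP/(_ w) + uw; rewrite uw negbK => /eqP.
  by apply/permP => w; rewrite perm1; apply: (@nbr_closed (fun u => s u = u) v).
right=> v.
have moves y : e v y -> exists t, [/\ t \in N, t v = v & t y != y].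
  move=> vy; have [s sN /existsP[u /andP[/eqP su /existsP[w /andP[uw sw]]]]] := exists_inP loc.
  have [g gG [gu gw]] := G_arc uw vy.
  exists (s ^ g); split; first by rewrite memJ_norm // (subsetP (normal_norm nNG)).
    by rewrite conjgE !permM -gu permK su.
  by rewrite conjgE !permM -gw permK (inj_eq perm_inj).
move=> y y' vy vy'; have [->|yy'] := eqVneq y y'; first by exists 1; rewrite group1 !perm1.
have et t u : t \in N -> t v = v -> e v (t u) = e v u by move=> tN {1}<-; rewrite G_aut ?NG.
have [t [tN tv ty]] := moves y vy; have [t' [tN' tv' ty']] := moves y' vy'.
have [e1|n1] := eqVneq (t y) y'; first by exists t.
have [e2|n2] := eqVneq (t' y') y.
  exists t'^-1; rewrite groupV; split=> //; first by rewrite -{1}tv' permK.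
  by rewrite -e2 permK.
have e3 : t y = t' y'.
  apply: (@nbr_third v y y'); rewrite ?et // eq_sym //.
exists (t * t'^-1); split; first by rewrite groupM ?groupV.
  by rewrite permM tv -{1}tv' permK.
by rewrite permM e3 permK.
Qed.

(* A locally transitive group has at most two orbits, which have equal length when it is
   normal in G. *)
Lemma local_normal_card (Q : {group {perm V}}) (v0 : V) : Q <| G ->
  (forall v y y', e v y -> e v y' -> exists t, [/\ t \in Q, t v = v & t y = y']) ->
  #|V| %| 2 * #|Q|.
Proof.
move=> nQG loc; have [w0 [vw _ _]] := nbr_avoid v0 v0 v0.
have wv : e w0 v0 by rewrite e_sym.
have QG := subsetP (normal_sub nQG).
have [g gG gv] := vertex_transitive v0 w0.
have Vorb u : u \in orbit 'P Q v0 :|: orbit 'P Q w0.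
  apply: (@nbr_closed (fun u => u \in orbit 'P Q v0 :|: orbit 'P Q w0) v0).
    by rewrite inE orbit_refl.
  move=> x y /setUP[] /orbitP[s sQ /= <-] {x} sy.
    have /(loc _ _ _ vw)[t [tQ tv tw]] : e v0 (s^-1 y).
      by rewrite -(G_aut (QG _ sQ)) permKV.
    apply/setUP; right; apply/orbitP; exists (t * s); first exact: groupM.
    by rewrite /= /aperm permM tw permKV.
  have /(loc _ _ _ wv)[t [tQ tv tw]] : e w0 (s^-1 y).
    by rewrite -(G_aut (QG _ sQ)) permKV.
  apply/setUP; left; apply/orbitP; exists (t * s); first exact: groupM.
  by rewrite /= /aperm permM tw permKV.
have cO : #|orbit 'P Q w0| = #|orbit 'P Q v0|.
  rewrite -(card_imset (orbit 'P Q v0) (@perm_inj _ g)); apply: eq_card => u.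
  have nQg := subsetP (normal_norm nQG) _ gG.
  apply/orbitP/imsetP => [[s sQ <-]|[_ /orbitP[s sQ <-] ->]].
    exists (aperm v0 (s ^ g^-1)); last by rewrite /= /aperm conjgE invgK !permM permKV gv.
    by apply/orbitP; exists (s ^ g^-1); rewrite // memJ_norm // groupV.
  exists (s ^ g); first by rewrite memJ_norm.
  by rewrite /= /aperm conjgE !permM -gv permK.
have cQ : #|orbit 'P Q v0| %| #|Q| by rewrite -(card_orbit_stab 'P Q v0) dvdn_mulr.
have cV : #|V| = #|orbit 'P Q v0 :|: orbit 'P Q w0|.
  by rewrite -cardsT; apply: eq_card => u; rewrite Vorb inE.
have [w_in|w_out] := boolP (w0 \in orbit 'P Q v0).
  by have /orbit_eqP ow := w_in; rewrite cV ow setUid dvdn_mull.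
rewrite cV cardsU (_ : _ :&: _ = set0).
  by rewrite cards0 subn0 cO addnn -mul2n dvdn_pmul2l.
apply/setP => u; rewrite !inE; apply/negP => /andP[uv uw]; case/negP: w_out.
by apply: orbit_trans uv; rewrite orbit_sym.
Qed.

(** In a transitive abelian group an element fixing one point fixes all. Applied to the neighbours
    of one vertex after another, this spreads the fixed points of [s] over the graph. *)
Lemma abelian_vertex_stab v u : (forall w, abelian 'C_G[w | 'P]) -> e v u ->
  forall s, s \in G -> s v = v -> s u = u -> s = 1.
Proof.
move=> abG vu s sG sv su.
have fixN x y w : e x y -> s x = x -> s y = y -> e x w -> s w = w.
  move=> xy sx sy xw; have [t tG [tx ty]] := G_arc xy xw.
  have st : commute s t.
    by apply: (centsP (abG x)); apply/setIP; split=> //; apply/astab1P.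
  by rewrite -ty -permM -st permM sy.
apply/permP => w; rewrite perm1.
suff [] : s w = w /\ exists2 y, e w y & s y = y by [].
apply: (@nbr_closed (fun w => s w = w /\ exists2 y, e w y & s y = y) v).
  by split=> //; exists u.
move=> x y [sx [z xz sz]] xy; split; last by exists x; rewrite // e_sym.
exact: fixN xz sx sz xy.
Qed.

(** * Exclusion of large primes *)

Lemma no_large_prime l p : prime l -> l = 5 %[mod 6] -> prime p -> #|V| = (2 * l * p)%N ->
  2 * l * 3 ^ 7 < p -> False.
Proof.
move=> prl l5 prp cV p_large.
have l_gt0 := prime_gt0 prl; have p_gt0 := prime_gt0 prp.
have [v0 _] : exists v0 : V, v0 \in V.
  by apply/card_gt0P; rewrite cV !muln_gt0 l_gt0.
have stab_le v : #|'C_G[v | 'P]| <= 3 ^ 7.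
  have := card_aut_le v0; rewrite (card_aut_vertex v) leq_pmul2l // cV !muln_gt0 l_gt0.
  by [].
have stab_lt v : 2 * l * #|'C_G[v | 'P]| < p.
  by apply: leq_ltn_trans p_large; rewrite leq_mul2l stab_le orbT.
have stab_p v : coprime #|'C_G[v | 'P]| p.
  rewrite coprime_sym prime_coprime // gtnNdvd ?cardG_gt0 //.
  by apply: leq_ltn_trans (stab_lt v); rewrite leq_pmull // muln_gt0.
have [P sylP] := Sylow_exists p G.
have cG : #|G| = (p * (2 * l * #|'C_G[v0 | 'P]|))%N by rewrite (card_aut_vertex v0) cV; lia.
have [nPG cP] := Sylow_normal_small_index prp cG (stab_lt v0) sylP.
have cycP : cyclic P by rewrite prime_cyclic ?cP.
pose N := 'C_G(P)%G.
have nNG : N <| G.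
  by apply: norm_normalI; apply: subset_trans (cent_norm P); apply: normal_norm.
have p_gt2 : 2 < p.
  by apply: leq_ltn_trans p_large; rewrite -mulnA leq_pmulr // muln_gt0 l_gt0.
have comN x y : x \in G -> y \in G -> [~ x, y] \in N by move=> xG yG; apply: commg_cent_cyclic.
have [regN|locN] := normal_semiregular_or_local nNG; last first.
  have sylPN : p.-Sylow(N) P.
    apply: pHall_subl (subsetIl _ _) sylP.
    by rewrite subsetI normal_sub // -abelianE cyclic_abelian.
  have hallQ := central_Sylow_pcore sylPN (subsetIr _ _).
  have nQN : 'O_p^'(N) <| N by apply: pcore_normal.
  have nQG : 'O_p^'(N) <| G by apply: char_normal_trans nNG; apply: pcore_char.
  have : #|V| %| 2 * #|'O_p^'(N)|.
    apply: (local_normal_card v0 nQG) => v y y' vy vy'.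
    have [t [tN tv ty]] := locN v y y' vy vy'; exists t; split=> //.
    (* Vertex stabilisers have order prime to [p], so their elements in [N] already lie in the
       normal Hall subgroup and local transitivity passes to it. *)
    rewrite (mem_normal_Hall hallQ nQN) // /p_elt p'natE //.
    have tGv : t \in 'C_G[v | 'P].
      by apply/setIP; split; [apply: subsetP tN; apply: normal_sub | apply/astab1P].
    have := stab_p v; rewrite coprime_sym prime_coprime //; apply: contraNN.
    by move/dvdn_trans; apply; apply: order_dvdG.
  move/(dvdn_trans (_ : p %| #|V|)); rewrite cV dvdn_mull // => /(_ isT).
  rewrite Euclid_dvdM // gtnNdvd //=.
  by apply/negP; rewrite -p'natE //; apply: pcore_pgroup.
have p_ne3 : p != 3.
  apply: contraTneq p_large => ->; rewrite -leqNgt; apply: leq_trans (_ : 1 * 3 ^ 7 <= _) => //.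
  by rewrite leq_mul2r muln_gt0 l_gt0.
(* A commutator of two elements fixing [w] fixes [w] and lies in the semiregular [N]. *)
have abG w : abelian 'C_G[w | 'P].
  apply/centsP => s /setIP[sG /astab1P sw] t /setIP[tG /astab1P tw]; apply/commgP/eqP.
  apply: (regN _ w (comN _ _ sG tG)).
  have fixV (x : {perm V}) : x w = w -> x^-1 w = w by move=> xw; rewrite -{1}xw permK.
  have {}sw : s w = w := sw; have {}tw : t w = w := tw.
  by rewrite commgEl conjgE !permM !fixV // sw tw.
have [u [vu _ _]] := nbr_avoid v0 v0 v0.
have triv s : s \in G -> s v0 = v0 -> s u = u -> s = 1 by exact: abelian_vertex_stab.
have card_stab : #|'C_G[v0 | 'P]| = 3.
  rewrite -(card_orbit_stab 'P 'C_G[v0 | 'P] u).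
  have -> : 'C_('C_G[v0 | 'P])[u | 'P] = 1.
    apply/trivgP/subsetP => s /setIP[/setIP[sG /astab1P sv] /astab1P su].
    by apply/set1P/triv.
  rewrite cards1 muln1 -(e_cubic v0); apply: eq_card => w; rewrite inE.
  apply/orbitP/idP => [[s /setIP[sG /astab1P sv] /= <-]|vw].
    by rewrite /= /aperm -{1}sv /= /aperm G_aut.
  have [s sG [sv su]] := G_arc vu vw.
  by exists s => //; apply/setIP; split=> //; apply/astab1P.
have [w [vw wu _]] := nbr_avoid v0 u u.
have [h hG [hv hu]] := G_arc vu vw.
have hGv : h \in 'C_G[v0 | 'P] by apply/setIP; split=> //; apply/astab1P.
have h3 : h ^+ 3 = 1 by apply/eqP; rewrite -order_dvdn -card_stab order_dvdG.
have defGv : 'C_G[v0 | 'P] = <[h]>.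
  apply/esym/eqP; rewrite eqEcard cycle_subG hGv card_stab.
  have : #[h] %| 3 by rewrite order_dvdn h3.
  case/(primeP (isT : prime 3)).2/orP => /eqP; last by rewrite orderE => ->.
  move/eqP; rewrite order_eq1 => /eqP h1; rewrite -hu h1 perm1 eqxx in wu; by [].
have uv : e u v0 by rewrite e_sym.
have [a aG [av au]] := G_arc vu uv.
have a2 : a ^+ 2 = 1.
  by apply: triv; rewrite ?groupX // expgS expg1 permM ?av ?au.
have defG : G :=: <<[set h; a]>>.
  set K := <<[set h; a]>>.
  have hK : h \in K by rewrite mem_gen // !inE eqxx.
  have aK : a \in K by rewrite mem_gen // !inE eqxx orbT.
  have KG : K \subset G by rewrite gen_subG; apply/subsetP => x /set2P[] ->.
  have GvK s : s \in G -> s v0 = v0 -> s \in K.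
    move=> sG sv; have : s \in 'C_G[v0 | 'P] by apply/setIP; split=> //; apply/astab1P.
    by rewrite defGv; apply: subsetP; rewrite cycle_subG.
  have trK x : exists2 k, k \in K & x = k v0.
    apply: (@nbr_closed (fun x => exists2 k, k \in K & x = k v0) v0).
      by exists 1; rewrite ?group1 ?perm1.
    move=> _ y [k kK ->] ky; have kG := subsetP KG _ kK.
    have vy : e v0 (k^-1 y) by rewrite -(G_aut kG) permKV.
    have [s sG [sv su]] := G_arc vu vy.
    (* Products act left to right: [a] sends [v0] to [u], [s] sends [u] to [k^-1 y], and [k] sends
       that to [y]. *)
    exists (a * s * k); first by rewrite !groupM // GvK.
    by rewrite !permM av su permKV.
  apply/eqP; rewrite eqEsubset KG andbT; apply/subsetP => s sG.
  have [k kK sk] := trK (s v0); have kG := subsetP KG _ kK.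
  rewrite -(mulgKV k s) groupM // GvK ?groupM ?groupV //.
  by rewrite permM sk permK.
have nP := subsetP (normal_norm nPG).
have card_GP : #|G / P| = (6 * l)%N.
  apply/eqP; rewrite (card_quotient (normal_norm nPG)) -(eqn_pmul2l p_gt0) -{1}cP.
  rewrite (Lagrange (normal_sub nPG)) cG card_stab.
  by rewrite (_ : 2 * l * 3 = 6 * l)%N //; clear; lia.
apply: (@no_group_order_six_mul _ (G / P)%G (N / P)%G (coset P h) (coset P a) l) => //.
- exact: quotient_normal.
(* An element of order 3 in [N] would act on [V] without fixed points, so 3 would divide [2 l p];
   but 3 is neither [l] nor [p]. *)
- apply/negP => d3.
  have : 3 %| #|N| by apply: dvdn_trans d3 (dvdn_quotient _ _).
  case/Cauchy => // s sN s3.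
  have p3 : 3.-group <[s]> by rewrite /pgroup -orderE s3.
  have act : [acts <[s]>, on [set: V] | 'P] by apply/actsP => x _ y; rewrite !inE.
  have := pgroup_fix_mod p3 act; rewrite cardsT (_ : 'Fix_(_ | 'P)(_) = set0).
    rewrite cards0 cV mod0n => /eqP; rewrite -/(dvdn _ _) !Euclid_dvdM //= !dvdn_prime2 //.
    rewrite ![3 == _]eq_sym (negPf p_ne3) orbF => /eqP l3; by rewrite l3 in l5.
  apply/setP => x; rewrite in_set0; apply/negP => /setIP[_ /afixP/(_ s (cycle_id s)) sx].
  by move: s3; rewrite (regN s x sN sx) order1.
- rewrite /= {1}defG quotient_gen ?quotientU ?quotient_set1 ?nP //.
  by apply/subsetP => x /set2P[] ->; apply: nP.
- by rewrite /= -morphX ?nP // h3 morph1.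
- by rewrite /= -morphX ?nP // a2 morph1.
- by rewrite /= -morphR ?nP //; apply: mem_quotient; apply: comN.
Qed.
End CubicGraph.

(** * Finiteness in bounded order, and primes congruent to 5 modulo 6 *)

Lemma finitely_many_bounded_order (P : sgraph -> Prop) B :
  (forall G, P G -> #|G| <= B) -> finitely_many_up_to_iso P.
Proof.
(* Codes are arbitrary Boolean tables; [adj] symmetrises them and removes loops, so that each one
   yields a graph. *)
move=> PB; pose code := {m : 'I_B.+1 & {ffun 'I_m * 'I_m -> bool}}.
pose adj (c : code) x y := (x != y) && (tagged c (x, y) || tagged c (y, x)).
have adj_sym c : symmetric (adj c) by move=> x y; rewrite /adj eq_sym orbC.
have adj_irr c : irreflexive (adj c) by move=> x; rewrite /adj eqxx.
exists #|{: code}|, (fun i => SGraph (adj_sym (enum_val i)) (adj_irr (enum_val i))) => G PG.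
have GB : #|G| < B.+1 by rewrite ltnS PB.
pose c : code := @Tagged _ (Ordinal GB) (fun m : 'I_B.+1 => {ffun 'I_m * 'I_m -> bool})
  [ffun u => sedge (enum_val (u.1 : 'I_#|G|)) (enum_val (u.2 : 'I_#|G|))].
exists (enum_rank c); rewrite enum_rankK.
exists (@enum_rank G : G -> 'I_#|G|); first exact: enum_rank_bij.
move=> x y; rewrite /= /adj /= !ffunE /= !enum_rankK (inj_eq enum_rank_inj) [sedge y x]sedge_sym orbb.
by case: eqP => // ->; rewrite sedge_irrefl.
Qed.

(** Factors of [m] are 1 or 5 modulo 6; if the least prime factor is 1, its cofactor is 5 and
    smaller than [m]. *)
Lemma prime_dvd_5mod6 m : m %% 6 = 5 -> exists l, [/\ prime l, l %| m & l %% 6 = 5].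
Proof.
have [k] := ubnP m; elim: k m => // k IH m mk m5.
have m_gt1 : 1 < m by lia.
have [r5|rN5] := eqVneq (pdiv m %% 6) 5.
  by exists (pdiv m); rewrite pdiv_prime ?pdiv_dvd.
have /dvdnP[q mq] := pdiv_dvd m.
have q5 : q %% 6 = 5.
  have := m5; rewrite {1}mq -modnMm.
  have := ltn_pmod q (isT : 0 < 6); have := ltn_pmod (pdiv m) (isT : 0 < 6).
  move: (q %% 6) (pdiv m %% 6) rN5.
  by do 6?[case=> //]; do 6?[case=> //].
have q_lt : q < k.
  by have := prime_gt1 (pdiv_prime m_gt1); nia.
have [l [prl lq l5]] := IH q q_lt q5.
by exists l; split=> //; rewrite mq dvdn_mulr.
Qed.

(** Euclid's argument applied to 6 n! - 1. *)
Lemma infinite_primes_5mod6 n : exists l, [/\ prime l, n < l & l %% 6 = 5].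
Proof.
have f_gt0 := fact_gt0 n.
have [l [prl lm l5]] := @prime_dvd_5mod6 (6 * n`!).-1 ltac:(lia).
exists l; split=> //; rewrite ltnNge; apply/negP => ln.
have lf : l %| 6 * n`! by rewrite dvdn_mull // dvdn_fact // prime_gt0.
have : l %| 1.
  by rewrite -(dvdn_addr 1 lm) addn1 prednK // muln_gt0.
by rewrite dvdn1 => /eqP l1; rewrite l1 in prl.
Qed.

Lemma finitely_many_double_prime l : prime l -> l = 5 %[mod 6] ->
  finitely_many_up_to_iso (connected_symmetric_cubic_of_order_mul_prime (2 * l)).
Proof.
move=> prl l5; apply: (@finitely_many_bounded_order _ (2 * l * (2 * l * 3 ^ 7))).
move=> G [conG cubG arcG [p prp cG]]; rewrite cG leq_mul2l; apply/orP; right.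
rewrite leqNgt; apply/negP => p_large.
apply: (@no_large_prime G (@sedge G) (automorphism_group G) _ cubG conG _ _ l p) => //.
- exact: sedge_sym.
- by move=> s /automorphismsP.
move=> u v u' v' uv uv'.
have arc_in x y : sedge x y -> (x, y) \in arcs G by rewrite inE.
by have [s sG [-> ->]] := atransP2 arcG (arc_in _ _ uv) (arc_in _ _ uv'); exists s.
Qed.

Theorem theorem20 :
  infinite_set [set k : nat | [/\ 0 < k, ~~ odd k &
      finitely_many_up_to_iso (connected_symmetric_cubic_of_order_mul_prime k)]]%classic
  /\
  (forall l : nat, prime l -> l = 5 %[mod 6] ->
     finitely_many_up_to_iso (connected_symmetric_cubic_of_order_mul_prime (2 * l))).
Proof.
split; last exact: finitely_many_double_prime.
move=> /finite_seqP[s sE].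
(* [sumn s] bounds every entry of [s], so [2 * l] cannot be one of them. *)
have [l [prl ls l5]] := infinite_primes_5mod6 (sumn s).
have : (2 * l)%N \in s.
  suff : [set` s]%classic (2 * l) by [].
  rewrite -sE; split; last exact: finitely_many_double_prime.
    by rewrite muln_gt0 (prime_gt0 prl).
  by rewrite oddM.
elim: s {sE} ls => //= a s IH ls; rewrite inE => /predU1P[|/IH]; first lia.
by apply; lia.
Qed.
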